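(* Let $f:\mathbb{Z}\to\mathbb{R}$ be a function of bounded variation, i.e. $f\in BV(\mathbb{Z})$. For every $\alpha\in[\tfrac13,+\infty)$ we have $$\operatorname{Var}(\mathcal{M}^{\alpha}f)\le \operatorname{Var}(f).$$
   Context: For $g:\mathbb{Z}\to\mathbb{R}$ and a finite integer interval $[a..b]=\{a,a+1,\dots,b\}$, $\operatorname{Var}_{[a..b]}(g)=\sum_{i=a}^{b-1}|g(i+1)-g(i)|$. The total variation $\operatorname{Var}(g)$ is the supremum of $\operatorname{Var}_{[a..b]}(g)$ over all finite integer intervals, and $BV(\mathbb{Z})=\{g:\mathbb{Z}\to\mathbb{R} : \operatorname{Var}(g)<\infty\}$. For $\alpha>0$, the discrete nontangential Hardy–Littlewood maximal operator is $$\mathcal{M}^{\alpha}f(x)=\sup\left\{\frac{1}{2R+1}\sum_{i=y-R}^{y+R}|f(i)| \;:\; R\in\mathbb{N},\ y\in\mathbb{Z},\ |x-y|\le\lceil \alpha R\rceil\right\},\qquad x\in\mathbb{Z},$$ where $\mathbb{N}$ includes $0$ and $\lceil\cdot\rceil$ is the ceiling function. *)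

(* Defs.v *)
From mathcomp Require Import all_boot all_order all_algebra.
From mathcomp Require Import classical_sets reals constructive_ereal ereal.

Set Implicit Arguments.
Unset Strict Implicit.
Unset Printing Implicit Defensive.

Import Order.TTheory GRing.Theory Num.Theory.

Local Open Scope classical_set_scope.
Local Open Scope ring_scope.

(* The index i = a + k runs over a, ..., b - 1; only meaningful for a <= b,
   since `|b - a|%N is the absolute value of b - a. *)
Definition var_on (R : realType) (g : int -> R) (a b : int) : R :=
  \sum_(0 <= k < `|b - a|%N) `|g (a + k%:Z + 1) - g (a + k%:Z)|.

Definition total_var (R : realType) (g : int -> R) : \bar R :=
  ereal_sup [set v | exists a b : int, a <= b /\ v = (var_on g a b)%:E].

Definition BVZ (R : realType) (g : int -> R) : Prop :=
  (total_var g < +oo)%E.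

(* The index i = y - r + k runs over y - r, ..., y + r. *)
Definition ball_avg (R : realType) (f : int -> R) (y : int) (r : nat) : R :=
  ((2 * r + 1)%N%:R)^-1 *
    \sum_(0 <= k < (2 * r + 1)%N) `|f (y - r%:Z + k%:Z)|.

(* A real supremum: the set of averages is nonempty (r = 0, y = x), and it is
   bounded above whenever f is bounded, in particular when f is in BVZ. *)
Definition maximal (R : realType) (alpha : R) (f : int -> R) (x : int) : R :=
  sup [set v | exists (r : nat) (y : int),
         `|x - y| <= Num.ceil (alpha * r%:R) /\ v = ball_avg f y r].

(* Main.v *)
Require Import Defs.
From mathcomp Require Import all_boot all_order all_algebra.
From mathcomp Require Import boolp classical_sets reals constructive_ereal ereal.
From mathcomp Require Import zify ring lra.

Set Implicit Arguments.
Unset Strict Implicit.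
Unset Printing Implicit Defensive.

Import Order.TTheory GRing.Theory Num.Theory.
Local Open Scope ring_scope.

(** Write [g = |f|] and [M = maximal alpha f]; since [Var |f| <= Var f], it is
    enough to bound the variation of [M] on each interval by the variation of
    [g] on some interval.  Four facts about [g] and [M] suffice.

    - [g <= M], because single points are balls ([norm_le_maximal]).
    - If [M] has just risen to [M x], then [g] takes a value at least [M x] at
      or to the right of [x] ([maximal_rise]); the mirror image holds if [M]
      falls just after [x] ([maximal_fall]).  A ball that realizes [M x] does
      not reach [x - 1], so it lies as far to the right as it may; unless it is
      contained in [[x, +oo[], removing its two rightmost points gives a ball
      that still reaches [x], hence whose average is at most [M x], so one of
      the removed points has a large value.
    - On a plateau of [M] that is a strict local maximum of height [A], some
      point has [g >= A] ([maximal_peak]).  This is where [alpha >= 1/3]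
      matters.  The points reached by a ball of average [A] all lie in the
      plateau.  The ball splits into a left half, one or three central points
      and a right half; if [alpha >= 1/3] both halves are balls that reach the
      plateau or one of its two neighbours, so they have average at most [A],
      and the central points, which lie in the plateau, make up the difference.

    Given these facts, the oscillation of [M] is copied by [g]: at a peak [g]
    is at least as large as [M], at a valley at most as large, and the peak
    points and valley points alternate in the same order.  The initial and
    final monotone pieces are covered by [maximal_fall] and [maximal_rise].
    This is [var_on_transfer], proved by scanning the interval from left to
    right.

    The facts about rises, falls and peaks need balls that realize the
    supremum.  These exist wherever [M] is not minimal ([maximal_attained]): the
    average over a ball of large radius hardly changes when the ball is moved by
    a bounded distance, so large balls contribute at most [inf M + o(1)], and
    only finitely many small balls reach a given point. *)

(** * Variation on intervals *)

Lemma var_on_addn (R : realType) (g : int -> R) (a : int) (n : nat) :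
  var_on g a (a + n%:Z) =
  \sum_(0 <= k < n) `|g (a + k%:Z + 1) - g (a + k%:Z)|.
Proof. by rewrite /var_on addrAC subrr add0r. Qed.

Lemma var_on_refl (R : realType) (g : int -> R) (a : int) : var_on g a a = 0.
Proof. by rewrite -{2}[a]addr0 (var_on_addn _ _ 0) big_nil. Qed.

Lemma var_on_cat (R : realType) (g : int -> R) (a b c : int) :
  a <= b -> b <= c -> var_on g a c = var_on g a b + var_on g b c.
Proof.
move=> ab bc.
have [m bE] : exists m : nat, b = a + m%:Z by exists `|b - a|%N; lia.
rewrite {}bE in ab bc *; have [n ->] : exists n : nat, c = a + (m + n)%N%:Z 
  by exists `|c - (a + m%:Z)%R|%N; lia.
rewrite PoszD addrA !var_on_addn -addrA -PoszD var_on_addn.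
rewrite (big_cat_nat (n := m)) ?leq_addr //=; congr (_ + _).
rewrite -{1}[m]add0n big_addn addKn; apply: eq_bigr => k _.
by rewrite PoszD (addrC k%:Z) addrA.
Qed.

Lemma var_on_step (R : realType) (g : int -> R) (a : int) :
  var_on g a (a + 1) = `|g (a + 1) - g a|.
Proof. by rewrite (var_on_addn _ _ 1) big_nat1 addr0. Qed.

Lemma var_on_ge0 (R : realType) (g : int -> R) (a b : int) :
  0 <= var_on g a b.
Proof. by apply: sumr_ge0 => k _. Qed.

Lemma dist_le_var_on (R : realType) (g : int -> R) (a b : int) :
  a <= b -> `|g b - g a| <= var_on g a b.
Proof.
move=> ab; have [n ->] : exists n : nat, b = a + n%:Z by exists `|b - a|%N; lia.
rewrite var_on_addn; elim: n => [|n IHn].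
  by rewrite big_nil addr0 subrr normr0.
rewrite big_nat_recr //= -addn1 PoszD addrA.
apply: le_trans (ler_distD (g (a + n%:Z)) _ _) _.
by rewrite [leLHS]addrC lerD2r.
Qed.

Lemma var_on_cat_dist (R : realType) (g : int -> R) (a b c : int) :
  a <= b -> b <= c -> var_on g a b + `|g c - g b| <= var_on g a c.
Proof. by move=> ab bc; rewrite (var_on_cat g ab bc) lerD2l dist_le_var_on. Qed.

Lemma var_on_norm (R : realType) (g : int -> R) (a b : int) :
  var_on (fun x => `|g x|) a b <= var_on g a b.
Proof. by apply: ler_sum => k _; apply: ler_dist_dist. Qed.

(** * Comparing the variations of two functions *)

(** What is known after reading [M] from [a] to [x].  While [M] rises, a bound
    in terms of [g] is available only up to [t], the last valley or the starting
    point, where [g t <= M t]; the rise from there to the current height is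
    still owed, and [b] is the point where the current plateau starts, so that
    the peak point found on it lies to the right of [t].  While [M] falls, [t] is the last
    peak point, and the drop since then is owed. *)
Variant scan_state (R : realType) (g M : int -> R) (a x : int) : Prop :=
| ScanFlat of var_on M a x = 0
| ScanUp s t b of s <= t & t < b & b <= x & M (b - 1) < M b &
    (forall i, b <= i <= x -> M i = M b) &
    var_on M a x <= var_on g s t + (M b - g t)
| ScanDown s t of s <= t & t <= x &
    var_on M a x <= var_on g s t + (g t - M x).

(** Debts are paid when the direction changes: at a peak by the point with
    [g z >= M b] on the plateau, at a valley by [g x <= M x]. *)
Lemma scan_state_step (R : realType) (g M : int -> R) (a x : int) :
  (forall i, g i <= M i) ->
  (forall i, M (i + 1) < M i -> exists2 z, z <= i & M i <= g z) ->
  (forall b e, b <= e -> M (b - 1) < M b -> M (e + 1) < M b ->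
     (forall i, b <= i <= e -> M i = M b) ->
     exists2 z, b <= z <= e & M b <= g z) ->
  a <= x -> scan_state g M a x -> scan_state g M a (x + 1).
Proof.
move=> gM fall peak ax.
have varS : var_on M a (x + 1) = var_on M a x + `|M (x + 1) - M x|.
  by rewrite (@var_on_cat _ M a x (x + 1)) ?var_on_step //; lia.
have gMx := gM x.
have [lt_up|lt_dn|eqM] := ltgtP (M x) (M (x + 1)); last first.
- rewrite -eqM subrr normr0 addr0 in varS.
  case=> [v0|s t b st tb bx rise flat v|s t st tx v].
  + by apply: ScanFlat; rewrite varS.
  + apply: (@ScanUp _ _ _ _ _ s t b) => //; rewrite ?varS //; first lia.
    move=> i /andP[bi ix]; have [->|nix] := eqVneq i (x + 1).
      by rewrite -eqM; apply: flat; rewrite bx lexx.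
    by apply: flat; lia.
  + by apply: (@ScanDown _ _ _ _ _ s t); rewrite ?varS -?eqM //; lia.
- rewrite ler0_norm in varS; last by rewrite subr_le0 ltW.
  case=> [v0|s t b st tb bx rise flat v|s t st tx v].
  (* The first move is a fall: the point above it may lie to the left of [a]. *)
  + have [z zx gz] := fall _ lt_dn.
    apply: (@ScanDown _ _ _ _ _ z z) => //; first lia.
    rewrite varS v0 var_on_refl; lra.
  + have Mx : M x = M b by apply: flat; rewrite bx lexx.
    have [z /andP[bz zx] gz] : exists2 z, b <= z <= x & M b <= g z.
      by apply: peak => //; rewrite -Mx.
    have tz : t <= z by lia.
    apply: (@ScanDown _ _ _ _ _ s z); [lia|lia|].
    have := var_on_cat_dist g st tz; have := ler_norm (g z - g t).
    rewrite varS Mx; lra.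
  + by apply: (@ScanDown _ _ _ _ _ s t) => //; [lia | rewrite varS; lra].
- rewrite ger0_norm in varS; last by rewrite subr_ge0 ltW.
  have xK : x + 1 - 1 = x by rewrite addrK.
  have flat1 i : x + 1 <= i <= x + 1 -> M i = M (x + 1).
    by move=> ?; congr M; lia.
  case=> [v0|s t b st tb bx rise flat v|s t st tx v].
  + apply: (@ScanUp _ _ _ _ _ x x (x + 1)); rewrite ?xK //; first lia.
    rewrite varS v0 var_on_refl; lra.
  + have Mx : M x = M b by apply: flat; rewrite bx lexx.
    apply: (@ScanUp _ _ _ _ _ s t (x + 1)); rewrite ?xK //; first lia.
    rewrite varS Mx; lra.
  + apply: (@ScanUp _ _ _ _ _ s x (x + 1)); rewrite ?xK //; [lia|lia|].
    have := var_on_cat_dist g st tx; have := ler_norm (g t - g x).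
    rewrite distrC varS; lra.
Qed.

(** The interval for [g] may be larger than [[a, b]]: if [M] rises or falls at
    an end of [[a, b]], the point where [g] matches it can lie outside. *)
Lemma var_on_transfer (R : realType) (g M : int -> R) (a b : int) :
  (forall i, g i <= M i) ->
  (forall i, M (i - 1) < M i -> exists2 z, i <= z & M i <= g z) ->
  (forall i, M (i + 1) < M i -> exists2 z, z <= i & M i <= g z) ->
  (forall b e, b <= e -> M (b - 1) < M b -> M (e + 1) < M b ->
     (forall i, b <= i <= e -> M i = M b) ->
     exists2 z, b <= z <= e & M b <= g z) ->
  a <= b -> exists s t : int, s <= t /\ var_on M a b <= var_on g s t.
Proof.
move=> gM rise fall peak ab.
have : scan_state g M a b.
  have [n ->] : exists n : nat, b = a + n%:Z by exists `|b - a|%N; lia.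
  elim: n => [|n IHn]; first by apply: ScanFlat; rewrite addr0 var_on_refl.
  rewrite -addn1 PoszD addrA; apply: scan_state_step => //; lia.
case=> [->|s t c st tc cb up flat v|s t st tb v].
- by exists a, b; rewrite var_on_ge0.
- have [z cz gz] := rise _ up; have tz : t <= z by lia.
  exists s, z; split; first lia.
  have := var_on_cat_dist g st tz; have := ler_norm (g z - g t); lra.
- exists s, b; split; first lia.
  have := var_on_cat_dist g st tb; have := ler_norm (g t - g b).
  rewrite distrC; have := gM b; lra.
Qed.

(** * The points reached by a ball *)

Definition reach (R : realType) (alpha : R) (r : nat) : int :=
  Num.ceil (alpha * r%:R).

Lemma reach_ge_third (R : realType) (alpha : R) (r : nat) :
  3^-1 <= alpha -> r%:Z <= 3 * reach alpha r.
Proof.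
move=> halpha; rewrite -(ler_int R) intrM.
have := ceil_ge (alpha * r%:R); rewrite -/(reach _ _) => h.
have : 3^-1 * r%:R <= alpha * r%:R by rewrite ler_wpM2r.
change ((r%:Z)%:~R : R) with (r%:R : R).
change ((3 : int)%:~R : R) with (3 : R); lra.
Qed.

(** A ball whose reach is smaller than its radius has [alpha < 1], so the reach
    grows by at most one when the radius does. *)
Lemma reachS_le (R : realType) (alpha : R) (r : nat) :
  0 <= alpha -> reach alpha r.+1 < r.+1%:Z ->
  reach alpha r.+1 <= reach alpha r + 1.
Proof.
move=> alpha0 small.
have lt1 : alpha < 1.
  have : alpha * r.+1%:R < r.+1%:R.
    apply: le_lt_trans (ceil_ge _) _; rewrite -/(reach _ _).
    by rewrite -[ltRHS]/((r.+1%:Z)%:~R) ltr_int.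
  by rewrite -[X in _ < X -> _]mul1r ltr_pM2r // ltr0Sn.
rewrite /reach ceil_le_int intrD -natr1 mulrDr mulr1.
by rewrite lerD ?ceil_ge // ltW.
Qed.

(** * Window sums *)

Definition wsum (R : realType) (g : int -> R) (u : int) (n : nat) : R :=
  \sum_(0 <= k < n) g (u + k%:Z).

Lemma wsum_cat (R : realType) (g : int -> R) (u : int) (m n : nat) :
  wsum g u (m + n) = wsum g u m + wsum g (u + m%:Z) n.
Proof.
rewrite /wsum (big_cat_nat (n := m)) ?leq_addr //=; congr (_ + _).
rewrite -{1}[m]add0n big_addn addKn; apply: eq_bigr => k _.
by rewrite PoszD (addrC k%:Z) addrA.
Qed.

Lemma wsum_ge0 (R : realType) (g : int -> R) (u : int) (n : nat) :
  (forall i, 0 <= g i) -> 0 <= wsum g u n.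
Proof. by move=> g0; apply: sumr_ge0. Qed.

Lemma wsum_le_const (R : realType) (g : int -> R) (B : R) (u : int) (n : nat) :
  (forall i, g i <= B) -> wsum g u n <= n%:R * B.
Proof.
move=> gB; apply: le_trans (ler_sum _ (fun k _ => gB _)) _.
by rewrite sumr_const_nat subn0 mulr_natl.
Qed.

Lemma wsum_ge_witness (R : realType) (g : int -> R) (A : R) (u : int) (n : nat) :
  (0 < n)%N -> n%:R * A <= wsum g u n ->
  exists2 z, u <= z < u + n%:Z & A <= g z.
Proof.
case: n => // n _; elim: n => [|n IHn] in u *.
  rewrite mul1r /wsum big_nat1 addr0 => ?; exists u => //; lia.
rewrite -addn1 wsum_cat {2}/wsum big_nat1 addr0 natrD mulrDl mul1r.
have [le_last _|lt_last le_sum] := leP A (g (u + n.+1%:Z)).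
  by exists (u + n.+1%:Z) => //; lia.
have [|z uz gz] := IHn u; first by lra.
by exists z => //; lia.
Qed.

(** At most [`|u - v|] points of the first window lie outside the second.
    The error term does not depend on [n], so averages over long
    windows are nearly translation invariant. *)
Lemma wsum_shift (R : realType) (g : int -> R) (B : R) (u v : int) (n : nat) :
  (forall i, 0 <= g i) -> (forall i, g i <= B) ->
  wsum g u n <= wsum g v n + `|u - v|%N%:R * B.
Proof.
move=> g0 gB; set d := `|u - v|%N.
have [uv|vu] := leP u v.
- have vE : v = u + d%:Z by rewrite /d; lia.
  have : wsum g u (n + d) = wsum g u (d + n) by rewrite addnC.
  rewrite !wsum_cat -vE.
  have := wsum_ge0 (u + n%:Z) d g0; have := wsum_le_const u d gB; lra.
- have uE : u = v + d%:Z by rewrite /d; lia.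
  have : wsum g v (n + d) = wsum g v (d + n) by rewrite addnC.
  rewrite !wsum_cat -uE.
  have := wsum_ge0 v d g0; have := wsum_le_const (v + n%:Z) d gB; lra.
Qed.

Lemma wsum_opp (R : realType) (g : int -> R) (u : int) (n : nat) :
  wsum (fun x => g (- x)) u n = wsum g (- u - n%:Z + 1) n.
Proof.
rewrite /wsum big_nat_rev /= !big_nat; apply: eq_bigr => k /andP[_ kn].
by congr g; lia.
Qed.

Lemma ball_avg_wsum (R : realType) (f : int -> R) (y : int) (r : nat) :
  (2 * r + 1)%N%:R * ball_avg f y r
  = wsum (fun x => `|f x|) (y - r%:Z) (2 * r + 1).
Proof. by rewrite /ball_avg mulVKf // pnatr_eq0 addn1. Qed.

Lemma ball_avg_opp (R : realType) (f : int -> R) (y : int) (r : nat) :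
  ball_avg (fun x => f (- x)) y r = ball_avg f (- y) r.
Proof.
rewrite /ball_avg; congr (_ * _).
rewrite -[LHS]/(wsum (fun x => `|f (- x)|) (y - r%:Z) (2 * r + 1)).
rewrite (wsum_opp (fun x => `|f x|)) /wsum; apply: eq_bigr => k _.
by congr `|f _|; lia.
Qed.

Lemma maximal_opp (R : realType) (alpha : R) (f : int -> R) (x : int) :
  maximal alpha (fun i => f (- i)) x = maximal alpha f (- x).
Proof.
rewrite /maximal; congr sup; apply/seteqP; split=> v [r [y [xy ->]]].
- exists r, (- y); rewrite ball_avg_opp; split=> //.
  by rewrite -opprD normrN.
- exists r, (- y); rewrite ball_avg_opp opprK; split=> //.
  by rewrite -normrN opprD.
Qed.

(** * Attainment of the maximal function *)

Lemma ball_avg_le_maximal (R : realType) (alpha : R) (f : int -> R) (B : R)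
    (x y : int) (r : nat) :
  (forall i, `|f i| <= B) -> `|x - y| <= reach alpha r ->
  ball_avg f y r <= maximal alpha f x.
Proof.
move=> fB xy; apply: ub_le_sup; last by exists r, y.
exists B => v [s [z [_ ->]]].
rewrite -(ler_pM2l (x := (2 * s + 1)%N%:R)) ?ltr0n ?addn1 //.
by rewrite -addn1 ball_avg_wsum wsum_le_const.
Qed.

Lemma wsum_le_maximal (R : realType) (alpha : R) (f : int -> R) (B : R)
    (x y : int) (r : nat) :
  (forall i, `|f i| <= B) -> `|x - y| <= reach alpha r ->
  wsum (fun i => `|f i|) (y - r%:Z) (2 * r + 1)
  <= (2 * r + 1)%N%:R * maximal alpha f x.
Proof.
move=> fB xy; rewrite -ball_avg_wsum ler_wpM2l //.
exact: ball_avg_le_maximal fB xy.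
Qed.

Lemma norm_le_maximal (R : realType) (alpha : R) (f : int -> R) (B : R)
    (x : int) :
  (forall i, `|f i| <= B) -> `|f x| <= maximal alpha f x.
Proof.
move=> fB; have := @ball_avg_le_maximal R alpha f B x x 0 fB.
rewrite /ball_avg muln0 add0n invr1 mul1r big_nat1 subr0 addr0; apply.
by rewrite subrr normr0 /reach mulr0 ceil0.
Qed.

(** Used to bound finitely many averages away from a value that none of them
    equals. *)
Lemma gap_below (R : realType) (A : R) (s : seq R) :
  exists2 m, m < A & forall v, v \in s -> v < A -> v <= m.
Proof.
elim: s => [|w s [m mA IHs]]; first by exists (A - 1) => //; lra.
have [wA|Aw] := ltP w A.
- exists (Num.max w m); first by rewrite gt_max wA.
  move=> v; rewrite inE le_max => /predU1P[-> _|vs vA]; first by rewrite lexx.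
  by rewrite (IHs v) ?orbT.
- exists m => // v; rewrite inE => /predU1P[->|]; last exact: IHs.
  by rewrite ltNge Aw.
Qed.

(** A ball of radius [r] around [y] that reaches [x] becomes, after translation
    by [x' - x], a ball that reaches [x'], so its average is at most
    [maximal alpha f x' + O(1 / r)].  From some radius [r0] on this is at most the
    midpoint of the two values, and below [r0] there are finitely many balls to
    consider; if none of them had average [maximal alpha f x], the supremum at
    [x] would be smaller than it is. *)
Lemma maximal_attained (R : realType) (alpha : R) (f : int -> R) (B : R)
    (x x' : int) :
  (forall i, `|f i| <= B) -> maximal alpha f x' < maximal alpha f x ->
  exists (r : nat) (y : int),
    `|x - y| <= reach alpha r /\ ball_avg f y r = maximal alpha f x.
Proof.
move=> fB; set A := maximal alpha f x; set A' := maximal alpha f x' => lt_A'A.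
pose d := `|x - x'|%N; pose e := (A - A') / 2.
have e0 : 0 < e by rewrite /e; lra.
have B0 : 0 <= B by apply: le_trans (fB 0).
pose r0 := Num.bound (d%:R * B / e).
have large (y : int) (r : nat) : (r0 <= r)%N -> `|x - y| <= reach alpha r ->
    ball_avg f y r <= A' + e.
  move=> r0r xy.
  rewrite -(ler_pM2l (x := (2 * r + 1)%N%:R)) ?ltr0n ?addn1 // -addn1.
  rewrite ball_avg_wsum.
  have := wsum_shift (y - r%:Z) (y - (x - x') - r%:Z)
    (2 * r + 1) (fun i => normr_ge0 (f i)) fB.
  have -> : absz (y - r%:Z - (y - (x - x') - r%:Z))%R = d.
    by rewrite /d; congr absz; ring.
  have : `|x' - (y - (x - x'))| <= reach alpha r.
    by rewrite [X in `|X|](_ : _ = x - y) //; ring.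
  move=> /(wsum_le_maximal fB); rewrite -/A'.
  have dBe : d%:R * B <= (2 * r + 1)%N%:R * e.
    rewrite -ler_pdivrMr //; apply: ltW.
    have /archi_boundP/lt_le_trans : 0 <= d%:R * B / e.
      by apply: divr_ge0; [apply: mulr_ge0 | apply: ltW].
    by apply; rewrite ler_nat -/r0; lia.
  rewrite mulrDr; lra.
pose s := [seq ball_avg f (x - reach alpha r + k%:Z) r
  | r <- iota 0 r0, k <- iota 0 (2 * `|reach alpha r| + 1)].
have [m mA small] := gap_below A s.
apply: contrapT => not_attained.
have : A <= Num.max m (A' + e).
  apply: ge_sup.
    exists (ball_avg f x 0), 0%N, x; split=> //.
    by rewrite subrr normr0 mulr0 ceil0.
  move=> v [r [y [xy vE]]]; rewrite le_max.
  have [r0r|rr0] := leqP r0 r; first by rewrite vE large ?orbT.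
  rewrite small //.
    rewrite -/(reach alpha r) in xy.
    apply/allpairsPdep; exists r, `|y - (x - reach alpha r)%R|%N.
    rewrite !mem_iota; split; [lia|lia|rewrite vE; congr ball_avg; lia].
  rewrite lt_neqAle vE (@ball_avg_le_maximal R alpha f B) // andbT.
  by apply/eqP => avgA; apply: not_attained; exists r, y.
by rewrite le_max !leNgt mA /=; rewrite /e; lra.
Qed.

(** * Where the function catches up with its maximal function *)

(** A ball of radius [r] realizing the value at [x] does not reach [x - 1], so
    [x = y - reach alpha r].  If the reach is at least [r], the whole ball lies
    to the right of [x].  Otherwise the ball of radius [r - 1] and centre
    [y - 1], which is the old one without its two rightmost points, still
    reaches [x]; its average is at most that of the old ball, so the average of
    the two removed points is at least that value. *)
Lemma maximal_rise (R : realType) (alpha : R) (f : int -> R) (B : R) (x : int) :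
  (forall i, `|f i| <= B) -> 0 < alpha ->
  maximal alpha f (x - 1) < maximal alpha f x ->
  exists2 z, x <= z & maximal alpha f x <= `|f z|.
Proof.
move=> fB alpha0 up; set A := maximal alpha f x.
have [r [y [xy avgE]]] := maximal_attained fB up.
have ballA := ball_avg_wsum f y r.
rewrite {}avgE -/A in ballA; move/esym: ballA => ballA.
have yx : y - reach alpha r = x.
  (* Reaching [x - 1] would give [x - 1] the value [A] at least. *)
  have [xy'|] := boolP (`|x - 1 - y| <= reach alpha r); last by lia.
  have := wsum_le_maximal fB xy'.
  by rewrite ballA ler_pM2l ?ltr0n ?addn1 // leNgt up.
have [r_le|lt_r] := leP r%:Z (reach alpha r).
  have [||z yz fz] := @wsum_ge_witness R (fun i => `|f i|) A
    (y - r%:Z) (2 * r + 1).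
  - by rewrite addn1.
  - by rewrite -ballA lexx.
  by exists z => //; lia.
case: r => [|r] in xy ballA yx lt_r *.
  by move: lt_r; rewrite /reach mulr0 ceil0.
have reach_gt0 : 0 < reach alpha r.+1.
  by rewrite /reach ceil_gt0 mulr_gt0 ?ltr0Sn.
have reach1 := reachS_le (ltW alpha0) lt_r.
have xy' : `|x - (y - 1)| <= reach alpha r by lia.
have := wsum_le_maximal fB xy'; rewrite -/A.
have lenE : (2 * r.+1 + 1 = (2 * r + 1) + 2)%N by lia.
have startE : y - 1 - r%:Z = y - r.+1%:Z by lia.
rewrite startE => left_le.
rewrite lenE wsum_cat natrD mulrDl in ballA.
have [||z yz fz] := @wsum_ge_witness R (fun i => `|f i|) A
  (y - r.+1%:Z + (2 * r + 1)%N%:Z) 2; rewrite //; first by lra.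
by exists z => //; lia.
Qed.

Lemma maximal_fall (R : realType) (alpha : R) (f : int -> R) (B : R) (x : int) :
  (forall i, `|f i| <= B) -> 0 < alpha ->
  maximal alpha f (x + 1) < maximal alpha f x ->
  exists2 z, z <= x & maximal alpha f x <= `|f z|.
Proof.
move=> fB alpha0 down.
have [||z xz fz] := @maximal_rise R alpha (fun i => f (- i)) B (- x) _ alpha0.
- by move=> i.
- by rewrite !maximal_opp opprB opprK addrC.
exists (- z); first by lia.
by rewrite maximal_opp opprK in fz.
Qed.

(** Let a ball of radius [r] and centre [y] reach [b] and have average [A], the
    height of the plateau.  Since [maximal alpha f] is at least [A] on all
    points it reaches, they lie in the plateau.  For [r > 0] write [r = 2 q + 1 + m] with [m] in
    [{0, 1}]: the ball is the union of a ball of radius [q] on each side and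
    of the central window of [2 m + 1] points, where the choice of [m] makes the side windows
    odd, as windows of balls must be.  From [3 * reach alpha r >= r] and
    [3 * reach alpha q >= q] one gets [reach alpha r + reach alpha q >= q + 1],
    which says that each side ball reaches the plateau or the point next to it.
    So the side averages are at most [A], and the central one is at least
    [A]. *)
Lemma maximal_peak (R : realType) (alpha : R) (f : int -> R) (B : R)
    (b e : int) :
  (forall i, `|f i| <= B) -> 3^-1 <= alpha -> b <= e ->
  maximal alpha f (b - 1) < maximal alpha f b ->
  maximal alpha f (e + 1) < maximal alpha f b ->
  (forall i, b <= i <= e -> maximal alpha f i = maximal alpha f b) ->
  exists2 z, b <= z <= e & maximal alpha f b <= `|f z|.
Proof.
move=> fB halpha be up down flat; set A := maximal alpha f b.
have [r [y [near_b avgE]]] := maximal_attained fB up.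
have ballA := ball_avg_wsum f y r.
rewrite {}avgE -/A in ballA; move/esym: ballA => ballA.
have too_far x : maximal alpha f x < A -> reach alpha r < `|x - y|.
  move=> xA; rewrite ltNge; apply/negP => /(wsum_le_maximal fB).
  by rewrite ballA ler_pM2l ?ltr0n ?addn1 // leNgt xA.
have /= far_up := too_far _ up; have /= far_down := too_far _ down.
(* The neighbours [b - 1] and [e + 1] of the plateau also bound averages by
   [A].  For [m = 1] this extra point is needed, already for [r = 2]. *)
have near y' r' : b - 1 <= y' + reach alpha r' ->
    y' - reach alpha r' <= e + 1 ->
    wsum (fun i => `|f i|) (y' - r'%:Z) (2 * r' + 1)
    <= (2 * r' + 1)%N%:R * A.
  move=> yb ye; pose x := Num.max (b - 1) (y' - reach alpha r').
  have reach0 := reach_ge_third r' halpha.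
  have /(wsum_le_maximal fB)/le_trans : `|x - y'| <= reach alpha r'.
    by rewrite /x; lia.
  apply; rewrite ler_wpM2l //.
  have [->|xb] := eqVneq x (b - 1); first exact: ltW.
  have [->|xe] := eqVneq x (e + 1); first exact: ltW.
  by rewrite flat // /x; move: xb xe; rewrite /x; lia.
have [r_eq0|r0] := eqVneq r 0%N.
  rewrite {}r_eq0 in ballA near_b far_up far_down.
  exists y; first by move: near_b far_up far_down; rewrite /reach mulr0 ceil0; lia.
  by move: ballA; rewrite muln0 add0n /wsum big_nat1 subr0 addr0 mul1r => ->.
(* For odd [r], [m = 0]; for even [r], [m = 1]. *)
have [q [m [rE m1]]] : exists q m : nat, r = (2 * q + 1 + m)%N /\ (m <= 1)%N.
  exists (r.-1./2), (~~ odd r : nat); lia.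
have reach_r := reach_ge_third r halpha.
have reach_q := reach_ge_third q halpha.
have left_le : wsum (fun i => `|f i|) (y - r%:Z) (2 * q + 1)
    <= (2 * q + 1)%N%:R * A.
  by have := near (y - r%:Z + q%:Z) q; rewrite addrK; apply; lia.
have right_le : wsum (fun i => `|f i|) (y + m%:Z + 1) (2 * q + 1)
    <= (2 * q + 1)%N%:R * A.
  by have := near (y + m%:Z + 1 + q%:Z) q; rewrite addrK; apply; lia.
have lenE : (2 * r + 1 = (2 * q + 1) + ((2 * m + 1) + (2 * q + 1)))%N by lia.
rewrite lenE wsum_cat (wsum_cat _ _ (2 * m + 1)) in ballA.
rewrite natrD mulrDl (natrD _ (2 * m + 1)) mulrDl in ballA.
have middleE : y - r%:Z + (2 * q + 1)%N%:Z = y - m%:Z by lia.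
have rightE : y - m%:Z + (2 * m + 1)%N%:Z = y + m%:Z + 1 by lia.
rewrite middleE rightE in ballA.
have [||z yz fz] := @wsum_ge_witness R (fun i => `|f i|) A (y - m%:Z) (2 * m + 1).
- by rewrite addn1.
- lra.
by exists z => //; lia.
Qed.

(** * The variation inequality *)

Lemma bounded_of_BVZ (R : realType) (f : int -> R) :
  BVZ f -> exists B, forall i, `|f i| <= B.
Proof.
rewrite /BVZ => hf.
have var_le a b : a <= b -> ((var_on f a b)%:E <= total_var f)%E.
  by move=> ab; apply: ereal_sup_ubound; exists a, b.
have := var_le 0 0 (lexx _); case: (total_var f) hf var_le => // V _ var_le _.
exists (`|f 0| + V) => i.
have : `|f i - f 0| <= V.
  have [i0|/ltW i0] := leP 0 i.
    exact: le_trans (dist_le_var_on _ i0) (var_le _ _ i0).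
  rewrite distrC.
  exact: le_trans (dist_le_var_on _ i0) (var_le _ _ i0).
have := ler_normD (f 0) (f i - f 0); rewrite addrC subrK; lra.
Qed.

Theorem theorem1p8 (R : realType) (f : int -> R) (alpha : R)
    (hf : BVZ f) (halpha : 3^-1 <= alpha) :
  (total_var (maximal alpha f) <= total_var f)%E.
Proof.
have [B fB] := bounded_of_BVZ hf.
have alpha0 : 0 < alpha by apply: lt_le_trans halpha; rewrite invr_gt0.
apply: ge_ereal_sup => v [a [b [ab ->]]].
have [s [t [st le_st]]] :
    exists s t : int, s <= t /\
      var_on (maximal alpha f) a b <= var_on (fun i => `|f i|) s t.
  apply: var_on_transfer => // [i|i|i|c e].
  - exact: norm_le_maximal _ _ fB.
  - exact: maximal_rise fB alpha0.
  - exact: maximal_fall fB alpha0.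
  - exact: maximal_peak fB halpha.
apply: (@le_trans _ _ (var_on f s t)%:E).
  by rewrite lee_fin (le_trans le_st) // var_on_norm.
by apply: ereal_sup_ubound; exists s, t.
Qed.
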